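(* Let $\Gamma$ be a connected simple graph with vertices $v_1,\ldots,v_k$, and let $x_1,\ldots,x_k$ be positive integers. Let $\Gamma_{[x_1,\ldots,x_k]}$ be the clique--replaced graph (defined below), and put $$m_i=x_i+\sum_{v_j\in N_\Gamma(v_i)}x_j,\qquad \lambda_i=\frac{m_i}{x_i}\quad(i=1,\ldots,k),\qquad \Psi=\prod_{i=1}^k\lambda_i,\qquad n=x_1+\cdots+x_k .$$ Let $\mathbf{A}$ be the $k\times k$ adjacency matrix of the complement $\Gamma^c$ of $\Gamma$ (rows and columns indexed by $1,\ldots,k$ in the order $v_1,\ldots,v_k$), and for a nonempty subset $S\subseteq\{1,\ldots,k\}$ let $\mathbf{A}(S)$ be the principal submatrix of $\mathbf{A}$ with rows and columns indexed by $S$. Then the number of spanning trees of $\Gamma_{[x_1,\ldots,x_k]}$ is $$\kappa\left(\Gamma_{[x_1,\ldots,x_k]}\right)=\frac{\prod_{i=1}^{k}m_i^{x_i}}{\Psi\, n^2}\Big(\Psi+\sum_{\emptyset\neq S\subseteq\{1,\ldots,k\}}\det\mathbf{A}(S)\prod_{i\notin S}\lambda_i\Big).$$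
   Context: All graphs are simple. $N_\Gamma(v)$ denotes the set of neighbours of $v$ in $\Gamma$, and $\kappa(\cdot)$ denotes the number of spanning trees (the complexity) of a graph. The clique--replaced graph $\Gamma_{[x_1,\ldots,x_k]}$ is obtained from $\Gamma$ by replacing each vertex $v_i$ by a complete graph $K_{x_i}$ on $x_i$ new vertices, and, whenever $v_i$ and $v_j$ are adjacent in $\Gamma$, joining every vertex of the copy $K_{x_i}$ to every vertex of the copy $K_{x_j}$ (no other edges between different copies). The complement $\Gamma^c$ has the same vertex set as $\Gamma$, with two distinct vertices adjacent in $\Gamma^c$ iff they are not adjacent in $\Gamma$. *)

(* Defs.v *)
From mathcomp Require Import all_boot all_order all_algebra.
Set Implicit Arguments. Unset Strict Implicit. Unset Printing Implicit Defensive.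
Import Order.TTheory GRing.Theory Num.Theory.

Definition simple_graph (V : finType) (e : rel V) : Prop :=
  irreflexive e /\ symmetric e.

Definition connected_graph (V : finType) (e : rel V) : Prop :=
  forall u v : V, connect e u v.

Definition edge_set (V : finType) (e : rel V) : {set {set V}} :=
  [set [set p.1; p.2] | p in [set p : V * V | e p.1 p.2]].

Definition is_spanning_tree (V : finType) (e : rel V) (F : {set {set V}}) : bool :=
  [&& F \subset edge_set e, #|F| == #|V|.-1 &
      [forall u, forall v, connect [rel a b | [set a; b] \in F] u v]].

Definition kappa (V : finType) (e : rel V) : nat :=
  #|[set F : {set {set V}} | is_spanning_tree e F]|.

Definition cr_vertex (k : nat) (x : 'I_k -> nat) := {i : 'I_k & 'I_(x i)}.

Definition clique_replaced (k : nat) (e : rel 'I_k) (x : 'I_k -> nat)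
  : rel {i : 'I_k & 'I_(x i)} :=
  fun u v => (u != v) && ((tag u == tag v) || e (tag u) (tag v)).

Local Open Scope ring_scope.

Definition compl_adj (k : nat) (e : rel 'I_k) : 'M[rat]_k :=
  \matrix_(i, j) ((i != j) && ~~ e i j)%:R.

Definition principal_sub (k : nat) (A : 'M[rat]_k) (S : {set 'I_k}) : 'M[rat]_#|S| :=
  \matrix_(a, b) A (enum_val a) (enum_val b).

Definition m_of (k : nat) (e : rel 'I_k) (x : 'I_k -> nat) (i : 'I_k) : nat :=
  (x i + \sum_(j | e i j) x j)%N.

Definition lambda_of (k : nat) (e : rel 'I_k) (x : 'I_k -> nat) (i : 'I_k) : rat :=
  (m_of e x i)%:R / (x i)%:R.

(* Main.v *)
Require Import Defs.
From mathcomp Require Import all_boot all_order all_algebra all_fingroup.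
Set Implicit Arguments. Unset Strict Implicit. Unset Printing Implicit Defensive.
Import Order.TTheory GRing.Theory Num.Theory.
Local Open Scope ring_scope.

(** Temperley's form of the matrix-tree theorem: if L is the Laplacian of a graph
on n vertices and J the all-ones matrix, then det (L + J) = n^2 kappa.  Indeed
L + J is the Gram matrix of the oriented incidence matrix augmented by an all-ones
column, so by Cauchy-Binet its determinant is the sum of the squared maximal
minors; such a minor is +-n when the chosen columns are the ones and the edges of
a spanning tree, and 0 otherwise.  For the clique-replaced graph,
L + J = M + B A B^T with M the diagonal matrix of the m_i and B the
vertex-to-clique incidence matrix, and det (1 + X Y) = det (1 + Y X) reduces its
determinant to that of diag(lambda) + A, whose expansion by rows gives the
principal minors of A. *)

(** * Determinant identities over a commutative ring *)

Lemma det_add1_mulmxC (R : comNzRingType) (m n : nat)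
    (B : 'M[R]_(m, n)) (C : 'M[R]_(n, m)) :
  \det (1%:M + B *m C) = \det (1%:M + C *m B).
Proof.
(* Multiplying by the unipotent [T] on either side clears the upper right block of [X], leaving
   diagonal blocks [1 + B C], [1] in one case and [1], [1 + C B] in the other. *)
pose X := block_mx (1%:M : 'M[R]_m) (- B) C (1%:M : 'M[R]_n).
pose T := block_mx (1%:M : 'M[R]_m) B 0 (1%:M : 'M[R]_n).
have detT : \det T = 1 by rewrite det_ublock !det1 mulr1.
have <- : \det (T *m X) = \det (1%:M + B *m C).
  by rewrite mulmx_block !mul1mx !mulmx1 mul0mx !add0r addNr det_lblock det1 mulr1.
have <- : \det (X *m T) = \det (1%:M + C *m B).
  by rewrite mulmx_block !mul1mx !mulmx1 !mulmx0 !addr0 subrr det_lblock det1 mul1r addrC.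
by rewrite !det_mulmx mulrC.
Qed.

(* Cauchy-Binet for a Gram matrix, summed over ordered families of columns: every
   set of columns is counted n! times. *)
Lemma det_gram (R : comNzRingType) (I : finType) (n : nat) (c : I -> 'I_n -> R) :
  \sum_(f : {ffun 'I_n -> I}) \det (\matrix_(i, j) c (f i) j) ^+ 2
  = n`!%:R * \det (\matrix_(i, j) \sum_t c t i * c t j).
Proof.
pose X (f : {ffun 'I_n -> I}) := \matrix_(i, j) c (f i) j.
have -> : \det (\matrix_(i, j) \sum_t c t i * c t j)
  = \sum_(f : {ffun 'I_n -> I}) (\prod_i c (f i) i) * \det (X f).
  under eq_bigr => f _ do rewrite mulr_sumr.
  rewrite exchange_big /=; apply: eq_bigr => s _.
  under eq_bigr => i _ do rewrite mxE.
  rewrite bigA_distr_bigA mulr_sumr; apply: eq_bigr => f _.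
  rewrite big_split /= mulrCA; congr (_ * (_ * _)).
  by apply: eq_bigr => i _; rewrite mxE.
(* Precomposing [f] with [s] permutes the rows of [X f], and the sign this produces cancels
   [(-1) ^+ s]. Hence all n! Leibniz terms of one factor of the square contribute equally. *)
have termE (s : 'S_n) :
  \sum_(f : {ffun 'I_n -> I}) (-1) ^+ s * (\prod_i X f i (s i)) * \det (X f)
  = \sum_(f : {ffun 'I_n -> I}) (\prod_i c (f i) i) * \det (X f).
  pose h (u : 'S_n) (g : {ffun 'I_n -> I}) := [ffun i => g (u i)].
  have hK : cancel (h s) (h s^-1%g).
    by move=> g; apply/ffunP=> i; rewrite !ffunE permKV.
  have hK' : cancel (h s^-1%g) (h s).
    by move=> g; apply/ffunP=> i; rewrite !ffunE permK.
  rewrite (reindex (h s)) /=; last by exists (h s^-1%g) => ? _; rewrite ?hK ?hK'.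
  apply: eq_bigr => g _.
  have -> : X (h s g) = perm_mx s *m X g.
    by rewrite -row_permE; apply/matrixP=> i j; rewrite !mxE ffunE.
  rewrite det_mulmx det_perm mulrAC mulrA -signr_addb addbb mul1r mulrC.
  congr (_ * _); rewrite [RHS](reindex_inj (@perm_inj _ s)) /=.
  by apply: eq_bigr => i _; rewrite -row_permE !mxE.
transitivity (\sum_(s : 'S_n)
  \sum_(f : {ffun 'I_n -> I}) (\prod_i c (f i) i) * \det (X f)).
  under [RHS]eq_bigr => s _ do rewrite -(termE s).
  rewrite exchange_big /=; apply: eq_bigr => f _.
  by rewrite -mulr_suml expr2.
by rewrite sumr_const card_Sn mulr_natl.
Qed.

(* With B the matrix selecting S, the left-hand matrix is D (1 + B B^T (A - 1)) for a
   diagonal D, and B^T (A - 1) B is the principal submatrix of A - 1 on S. *)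
Lemma det_mix_rows (R : comNzRingType) (k : nat) (l : 'I_k -> R) (A : 'M[R]_k)
    (S : {set 'I_k}) :
  \det (\matrix_(i, j) (if i \in S then A i j else l i *+ (i == j)))
  = \det (\matrix_(a < #|S|, b < #|S|) A (enum_val a) (enum_val b))
    * \prod_(i in ~: S) l i.
Proof.
pose B : 'M[R]_(k, #|S|) := \matrix_(i, a) (i == enum_val a)%:R.
have BM p (Z : 'M[R]_(#|S|, p)) i j (iS : i \in S) :
  (B *m Z) i j = Z (enum_rank_in iS i) j.
  rewrite mxE (bigD1 (enum_rank_in iS i)) //= mxE enum_rankK_in // eqxx mul1r.
  rewrite big1 ?addr0 // => a ne; rewrite mxE; case: eqP => [ia|]; last by rewrite mul0r.
  by case/eqP: ne; apply: enum_val_inj; rewrite enum_rankK_in.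
have BM0 p (Z : 'M[R]_(#|S|, p)) i j : i \notin S -> (B *m Z) i j = 0.
  move=> iS; rewrite mxE big1 // => a _; rewrite mxE.
  case: eqP => [ia|]; last by rewrite mul0r.
  by rewrite ia enum_valP in iS.
have BT p (Z : 'M[R]_(k, p)) a j : (B^T *m Z) a j = Z (enum_val a) j.
  rewrite mxE (bigD1 (enum_val a)) //= !mxE eqxx mul1r big1 ?addr0 // => i ne.
  by rewrite !mxE (negbTE ne) mul0r.
have MB p (Z : 'M[R]_(p, k)) i a : (Z *m B) i a = Z i (enum_val a).
  rewrite mxE (bigD1 (enum_val a)) //= !mxE eqxx mulr1 big1 ?addr0 // => j ne.
  by rewrite !mxE (negbTE ne) mulr0.
pose d : 'rV[R]_k := \row_i (if i \in S then 1 else l i).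
have -> : \matrix_(i, j) (if i \in S then A i j else l i *+ (i == j))
  = diag_mx d *m (1%:M + B *m (B^T *m (A - 1%:M))).
  apply/matrixP=> i j; rewrite mul_diag_mx [LHS]mxE [RHS]mxE.
  rewrite [X in _ * X]mxE [X in _ * (X + _)]mxE.
  rewrite [d 0 i]mxE; case: ifP => iS; last first.
    by rewrite BM0 ?iS // addr0 mulr_natr.
  by rewrite (BM _ _ _ _ iS) BT enum_rankK_in // !mxE mul1r [RHS]addrC subrK.
rewrite det_mulmx det_diag det_add1_mulmxC mulrC; congr (_ * _).
  congr (\det _); apply/matrixP=> a b.
  by rewrite mxE MB BT !mxE (inj_eq enum_val_inj) [LHS]addrC subrK.
rewrite [RHS]big_mkcond /=; apply: eq_bigr => i _.
by rewrite mxE inE; case: (i \in S).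
Qed.

(** Each factor of a Leibniz product is a diagonal entry plus an entry of [A]; on distributing, [S]
    records the rows that take the entry of [A]. *)
Lemma det_diagD (R : comNzRingType) (k : nat) (l : 'I_k -> R) (A : 'M[R]_k) :
  \det (diag_mx (\row_i l i) + A)
  = \sum_(S : {set 'I_k})
      \det (\matrix_(a < #|S|, b < #|S|) A (enum_val a) (enum_val b))
      * \prod_(i in ~: S) l i.
Proof.
under [RHS]eq_bigr => S _ do rewrite -det_mix_rows.
rewrite exchange_big /=; apply: eq_bigr => s _; rewrite -mulr_sumr; congr (_ * _).
under eq_bigr => i _ do rewrite !mxE addrC.
rewrite bigA_distr; apply: eq_bigr => S _; apply: eq_bigr => i _.
by rewrite mxE.
Qed.

(** * Edges and the oriented incidence matrix *)

Lemma pair_in_edge_set (V : finType) (e : rel V) (a b : V) :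
  simple_graph e -> ([set a; b] \in edge_set e) = e a b.
Proof.
move=> [irr sym]; apply/imsetP/idP => [[[c d]] | eab]; last by exists (a, b); rewrite ?inE.
rewrite inE /= => ecd abcd.
have cd : c != d by apply: contraTneq ecd => ->; rewrite irr.
have : c \in [set a; b] by rewrite abcd !inE eqxx.
have : d \in [set a; b] by rewrite abcd !inE eqxx orbT.
rewrite !inE => /orP[] /eqP dE /orP[] /eqP cE; move: cd ecd; rewrite dE cE ?eqxx //.
by rewrite sym.
Qed.

Lemma edge_setP (V : finType) (e : rel V) (s : {set V}) :
  simple_graph e ->
  reflect (exists a b, [/\ a != b, e a b & s = [set a; b]]) (s \in edge_set e).
Proof.
move=> sg; apply: (iffP idP) => [/imsetP[[a b]] | [a [b [_ eab ->]]]].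
  rewrite inE /= => eab ->; exists a, b; split=> //.
  by apply: contraTneq eab => ->; rewrite sg.1.
by rewrite pair_in_edge_set.
Qed.

(** Edges are unordered pairs, so the endpoint returned by [pick] serves as head. *)
Definition orientation (V : finType) (s : {set V}) (v : V) : int :=
  if v \in s then (if [pick z in s] == Some v then 1 else -1) else 0.

Lemma orientation_pair (V : finType) (a b : V) : a != b ->
  exists2 c : int, c ^+ 2 = 1
    & forall v, orientation [set a; b] v = c * ((v == a)%:R - (v == b)%:R).
Proof.
move=> ab; have ba : b != a by rewrite eq_sym.
rewrite /orientation; case: pickP => [z | /(_ a)]; last by rewrite !inE eqxx.
rewrite !inE => /orP[] /eqP ->.
  exists 1; rewrite ?expr1n // => v; rewrite !inE (inj_eq Some_inj) mul1r eq_sym.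
  have [->|va] := eqVneq v a; first by rewrite (negbTE ab) subr0.
  by case: (eqVneq v b); rewrite //= sub0r.
exists (-1); rewrite ?sqrrN ?expr1n // => v; rewrite !inE (inj_eq Some_inj) mulN1r opprB.
rewrite orbC [b == v]eq_sym.
have [->|vb] := eqVneq v b; first by rewrite (negbTE ba) subr0.
by case: (eqVneq v a); rewrite //= sub0r.
Qed.

(* [None] indexes the all-ones column that accounts for the matrix J. *)
Definition incidence (V : finType) (e : rel V) (t : option {set V}) (v : V) : int :=
  if t is Some s then (if s \in edge_set e then orientation s v else 0) else 1.

(** On the diagonal every incident edge adds 1 to the 1 from the column of ones. Off the diagonal
    only the edge [[set u; v]] can contribute, and its -1 cancels that 1. *)
Lemma incidence_gram (V : finType) (e : rel V) (u v : V) : simple_graph e ->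
  \sum_t incidence e t u * incidence e t v
  = (u == v)%:R * (#|e u|.+1)%:R + ((u != v) && ~~ e u v)%:R.
Proof.
move=> sg; rewrite (bigD1 None) //= mul1r (reindex_omap Some id) /=; last by case.
under eq_bigl => s do rewrite eqxx.
have [<-|uv] := eqVneq u v.
  rewrite mul1r addr0 -natr1 addrC; congr (_ + _).
  (* Neighbours of [u] are counted through the edges [[set u; w]], so that both sides become sums
     over vertex sets. *)
  rewrite -(card_in_imset (f := fun w => [set u; w])); last first.
    move=> w w' uw uw' /setP/(_ w); rewrite !inE eqxx orbT => /esym/orP[]/eqP // wu.
    by move: uw; rewrite wu unfold_in sg.1.
  rewrite -sum1_card natr_sum [RHS]big_mkcond /=; apply: eq_bigr => s _.
  case: ifP => [/edge_setP [//|a [b [ab eab ->]]] | sE].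
    have [c c2 cE] := orientation_pair ab; rewrite -expr2 cE exprMn c2 mul1r.
    case: imsetP => [[w] | nw].
      rewrite unfold_in => uw abw.
      have : u \in [set a; b] by rewrite abw !inE eqxx.
      rewrite !inE => /orP[] /eqP ->; rewrite eqxx ?(negbTE ab) ?subr0 //.
      by rewrite eq_sym (negbTE ab) sub0r sqrrN.
    have [ua|ua] := eqVneq u a; first by case: nw; exists b; rewrite ?ua.
    have [ub|ub] := eqVneq u b; last by rewrite subrr.
    by case: nw; exists a; rewrite ?ub 1?setUC // unfold_in sg.2.
  case: imsetP => // -[w]; rewrite unfold_in => uw sw.
  by rewrite sw pair_in_edge_set // uw in sE.
rewrite mul0r add0r (bigD1 [set u; v]) //= big1 => [|s suv].
  rewrite addr0 pair_in_edge_set //; case: ifP => // _.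
  have [c c2 cE] := orientation_pair uv.
  rewrite !cE !eqxx (negbTE uv) eq_sym (negbTE uv) mulrACA -expr2 c2 //.
case: ifP => [sE|]; last by rewrite mul0r.
rewrite /orientation; case: ifP => us; last by rewrite mul0r.
case: (boolP (v \in s)) => vs; last by rewrite mulr0.
case/negP: suv; case/edge_setP: sE us vs => // a [b [ab _ ->]].
rewrite !inE => /orP[] /eqP uE /orP[] /eqP vE; move: uv; rewrite uE vE ?eqxx //.
by rewrite setUC eqxx.
Qed.

(** * Maximal minors of the augmented incidence matrix, chosen columns written as rows *)

Definition incidence_mx (V : finType) (e : rel V)
    (f : {ffun 'I_#|V| -> option {set V}}) : 'M[int]_#|V| :=
  \matrix_(i, j) incidence e (f i) (enum_val j).

Definition edges_of (V : finType) (f : {ffun 'I_#|V| -> option {set V}}) :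
  {set {set V}} := [set s | Some s \in codom f].

Lemma sum_delta (V : finType) (a : V) (w : V -> int) :
  \sum_v (v == a)%:R * w v = w a.
Proof.
by rewrite (bigD1 a) //= eqxx mul1r big1 ?addr0 // => v /negbTE ->; rewrite mul0r.
Qed.

(** Up to sign, an edge takes the difference of [w] at its two ends; a set that is not an edge has a
    zero row. *)
Lemma sum_incidence_edge (V : finType) (e : rel V) (s : {set V}) (w : V -> int) :
  simple_graph e -> {in s &, forall a b, w a = w b} ->
  \sum_v incidence e (Some s) v * w v = 0.
Proof.
move=> sg /=; case: (boolP (s \in edge_set e)) => [/edge_setP [//|a [b [ab _ ->]]] | _] ws.
  have [c _ cE] := orientation_pair ab.
  under eq_bigr => v _ do rewrite cE -mulrA mulrBl.
  by rewrite -mulr_sumr sumrB !sum_delta (ws a b) ?inE ?eqxx ?orbT // subrr mulr0.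
by rewrite big1 // => v _; rewrite mul0r.
Qed.

(* A component C of a disconnected edge set F gives the vector n 1_C - |C| 1
   in the kernel. *)
Lemma det_incidence_mx_neq0 (V : finType) (e : rel V) (v0 : V)
    (f : {ffun 'I_#|V| -> option {set V}}) : simple_graph e ->
  \det (incidence_mx e f) != 0 ->
  [/\ injective f, forall i, f i \in None |: Some @: edges_of f
    & is_spanning_tree e (edges_of f)].
Proof.
move=> sg nz.
have ker (w : V -> int) :
    (forall i, \sum_v incidence e (f i) v * w v = 0) -> forall v, w v = 0.
  move=> w0 v; apply/eqP; apply: contraNT nz => wv; rewrite -det_tr.
  apply/det0P; exists (\row_j w (enum_val j)).
    apply/eqP => /rowP/(_ (enum_rank v)); rewrite !mxE enum_rankK => /eqP.
    by rewrite (negbTE wv).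
  apply/rowP=> i; rewrite !mxE -[RHS](w0 i) (reindex _ (onW_bij _ (enum_val_bij V))) /=.
  by apply: eq_bigr => j _; rewrite !mxE mulrC.
have inj_f : injective f.
  move=> i j fij; apply/eqP; apply: contra_neqT nz => ij.
  by apply: (determinant_alternate ij) => l; rewrite !mxE fij.
have edge s : s \in edges_of f -> s \in edge_set e.
  rewrite inE => /codomP[i fi]; apply: contra_neqT nz => sE.
  by rewrite (expand_det_row _ i) big1 // => j _; rewrite mxE -fi /= (negbTE sE) mul0r.
(* Without the row of ones the constant vector 1 would lie in the kernel. *)
have noneP : None \in codom f.
  apply: contraT => nP.
  suff /ker/(_ v0) : forall i, \sum_v incidence e (f i) v * 1 = 0 by [].
  move=> i.
  case fi: (f i) => [s|]; last by rewrite -fi codom_f in nP.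
  exact: sum_incidence_edge.
have imf : [set f i | i in 'I_#|V|] = None |: Some @: edges_of f.
  apply/setP=> t; rewrite !inE; apply/imsetP/idP => [[i _ ->]|].
    case fi: (f i) => [s|] //=; apply/imsetP; exists s => //.
    by rewrite inE -fi codom_f.
  case/orP => [/eqP->|/imsetP[s]]; first by case/codomP: noneP => i; exists i.
  by rewrite inE => /codomP[i fi] ->; exists i.
have fG i : f i \in None |: Some @: edges_of f by rewrite -imf imset_f.
split=> //; apply/and3P; split; first by apply/subsetP.
  (* One of the [#|V|] distinct rows is [None], which leaves [#|V|.-1] edges. *)
  have := congr1 (fun A : {set _} => #|A|) imf.
  rewrite card_imset // card_ord cardsU1 (card_imset _ Some_inj).
  by case: imsetP => [[]|] // _ ->.
apply/forallP=> u; apply/forallP=> v; apply: contraT => nuv.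
set r := [rel a b | _] in nuv.
pose C := [set z | connect r u z].
(* Subtracting [#|C|] makes [w] sum to zero, as the row of ones requires; edge rows annihilate [w]
   because no chosen edge leaves [C]. As [v] is outside [C], [w v = 0] would force [C] to be
   empty. *)
pose w z : int := (z \in C)%:R * #|V|%:R - #|C|%:R.
suff /ker/(_ v)/eqP : forall i, \sum_z incidence e (f i) z * w z = 0.
  rewrite /w inE (negbTE nuv) mul0r sub0r oppr_eq0 pnatr_eq0 cards_eq0 => /eqP/setP/(_ u).
  by rewrite !inE connect0.
move=> i; case fi: (f i) => [s|].
  have /edge : s \in edges_of f by rewrite inE -fi codom_f.
  case/edge_setP => // a [b [_ _ sE]]; apply: sum_incidence_edge => //.
  have sF : s \in edges_of f by rewrite inE -fi codom_f.
  have conn y z : y \in s -> z \in s -> y \in C -> z \in C.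
    move=> ys zs; rewrite !inE => /connect_trans; apply.
    have [->|yz] := eqVneq y z; first exact: connect0.
    apply: connect1 => /=; suff <- : s = [set y; z] by [].
    move: ys zs yz; rewrite sE !inE => /orP[] /eqP-> /orP[] /eqP->; rewrite ?eqxx // => _.
    exact: setUC.
  move=> y z ys zs; congr ((nat_of_bool _)%:R * _ - _).
  by apply/idP/idP; apply: conn.
under eq_bigr => z _ do rewrite /= mul1r.
have sumC : \sum_z (z \in C)%:R = #|C|%:R :> int.
  by rewrite -sum1_card natr_sum [RHS]big_mkcond /=; apply: eq_bigr => z _; case: ifP.
by rewrite sumrB sumr_const -mulr_suml sumC mulr_natr subrr.
Qed.

(* The rows of the matrix of a spanning tree generate the lattice of integer vectors
   whose coordinate sum is divisible by n, which has index n. *)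
Lemma absz_det_incidence_mx (V : finType) (e : rel V) (v0 : V) (F : {set {set V}})
    (f : {ffun 'I_#|V| -> option {set V}}) : simple_graph e -> is_spanning_tree e F ->
  (forall t, t \in None |: Some @: F -> t \in codom f) ->
  `|\det (incidence_mx e f)|%N = #|V|.
Proof.
move=> sg /and3P[/subsetP FE _ /forallP Fconn] Ff.
set X := incidence_mx e f; set n := #|V|; pose i0 : 'I_n := enum_rank v0.
pose dlt (a : V) : 'rV[int]_n := \row_j (enum_val j == a)%:R.
have [i1 fi1] : exists i, f i = None.
  have /Ff/codomP[i] : None \in None |: Some @: F by rewrite !inE.
  by exists i.
have span_edge a b : [set a; b] \in F -> exists w : 'rV_n, w *m X = dlt a - dlt b.
  move=> abF; have /codomP[i fi] : Some [set a; b] \in codom f.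
    by apply: Ff; rewrite !inE /= imset_f.
  have eab : e a b by rewrite -pair_in_edge_set // FE.
  have ab : a != b by apply: contraTneq eab => ->; rewrite sg.1.
  have [c c2 cE] := orientation_pair ab.
  exists (c *: delta_mx 0 i); rewrite -scalemxAl -rowE; apply/rowP=> j.
  by rewrite !mxE -fi /= FE // cE mulrA -expr2 c2 mul1r.
have span a b : exists w : 'rV_n, w *m X = dlt a - dlt b.
  have /forallP/(_ b)/connectP[p] := Fconn a.
  elim: p a => [a _ -> | c p IHp a /= /andP[acF /IHp{}IHp] /IHp [w wE]].
    by exists 0; rewrite mul0mx subrr.
  have [w' w'E] := span_edge _ _ acF.
  by exists (w' + w); rewrite mulmxDl w'E wE addrA subrK.
have [W WE] := fin_all_exists (fun i : 'I_n => span (enum_val i) v0).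
(* [Y] is a basis of the lattice: row [i0] is n times the unit vector at [v0], and every other row
   is a unit vector minus that one. Being a rank-one perturbation of 1, it has determinant 1 + (n -
   1). *)
pose u : 'cV[int]_n := \col_i (if i == i0 then n%:R - 1 else -1).
pose Y := 1%:M + u *m delta_mx (0 : 'I_1) i0.
have dltE a l : dlt a 0 l = (l == enum_rank a)%:R.
  by rewrite mxE -(inj_eq enum_val_inj) enum_rankK.
have sumdlt : \sum_(j < n) dlt (enum_val j) = const_mx 1.
  apply/rowP=> l; rewrite summxE mxE (bigD1 l) //= dltE enum_valK eqxx.
  by rewrite big1 ?addr0 // => j jl; rewrite dltE enum_valK eq_sym (negbTE jl).
have YE i l : Y i l = (l == i)%:R + u i 0 * (l == i0)%:R.
  by rewrite mxE [X in _ + X]mxE big_ord1 mxE [delta_mx _ _ _ _]mxE /= eq_sym.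
have detY : \det Y = n%:R.
  rewrite /Y det_add1_mulmxC det_mx11 -rowE !mxE !eqxx.
  by rewrite [LHS]addrC subrK.
(* In row [i0], the row of ones minus the sum of all [dlt a - dlt v0] leaves n times [dlt v0]. *)
pose Z := \matrix_i (if i == i0 then delta_mx 0 i1 - \sum_j W j else W i).
have ZX : Z *m X = Y.
  apply/row_matrixP => i; rewrite row_mul rowK; apply/rowP=> l.
  rewrite [RHS]mxE YE [u i 0]mxE; case: (eqVneq i i0) => [->|_]; last first.
    by rewrite WE [LHS]mxE [X in _ + X]mxE !dltE enum_valK mulN1r.
  rewrite mulmxBl mulmx_suml -rowE; under eq_bigr => j _ do rewrite WE.
  rewrite sumrB sumr_const card_ord [LHS]mxE [X in _ + X]mxE.
  rewrite [row i1 X 0 l]mxE [X i1 l]mxE fi1 /=.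
  rewrite [X in 1 - X]mxE [X in _ - (_ + X)]mxE mulmxnE dltE sumdlt mxE subKr.
  by rewrite mulrBl mul1r [RHS]addrC subrK mulr_natl.
have dvdX : (\det X %| n%:R)%Z by rewrite -detY -ZX det_mulmx dvdz_mull.
have dvdn : (n%:R %| \det X)%Z.
  (* Edge rows sum to 0 and a row of ones to n; applying the adjugate then exhibits [\det X] as a
     multiple of n. *)
  have XE : X *m const_mx 1 = n%:R *: (\col_i (f i == None)%:R : 'cV_n).
    apply/matrixP=> i j; rewrite !mxE.
    transitivity (\sum_v incidence e (f i) v * 1).
      rewrite [RHS](reindex _ (onW_bij _ (enum_val_bij V))) /=.
      by apply: eq_bigr => l _; rewrite !mxE.
    case: (f i) => [s|]; first by rewrite sum_incidence_edge // mulr0.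
    by rewrite /= mulr1 sumr_const mulr1.
  have := congr1 (mulmx (\adj X)) XE.
  rewrite mulmxA mul_adj_mx mul_scalar_mx => /matrixP/(_ i0 0).
  by rewrite -scalemxAr !mxE mulr1 => ->; rewrite dvdz_mulr.
apply/eqP; rewrite eqn_dvd; move: dvdX dvdn; rewrite !dvdzE.
by rewrite natz /= => -> ->.
Qed.

(** In [det_gram], the nonzero terms come from the n! orderings of [None] and the edges of each
    spanning tree, each contributing n^2; then n! cancels. The vertex [v0] excludes the empty graph,
    where the left side is 1 and the right side 0. *)
Theorem det_laplacian_add_ones (V : finType) (e : rel V) (v0 : V) : simple_graph e ->
  \det (\matrix_(i < #|V|, j < #|V|)
     ((i == j)%:R * (#|e (enum_val i)|.+1)%:R
      + ((i != j) && ~~ e (enum_val i) (enum_val j))%:R : int))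
  = #|V|%:R ^+ 2 * (kappa e)%:R.
Proof.
move=> sg; set M := (X in \det X = _).
have ME : M = \matrix_(i, j)
    \sum_t incidence e t (enum_val i) * incidence e t (enum_val j).
  by apply/matrixP=> i j; rewrite !mxE incidence_gram // (inj_eq enum_val_inj).
have fact0 : #|V|`!%:R != 0 :> int by rewrite pnatr_eq0 -lt0n fact_gt0.
apply: (mulfI fact0); rewrite ME -(det_gram (fun t i => incidence e t (enum_val i))).
pose P (f : {ffun 'I_#|V| -> option {set V}}) := \det (incidence_mx e f) != 0.
pose G (F : {set {set V}}) := None |: Some @: F.
have Vgt0 : (0 < #|V|)%N by apply/card_gt0P; exists v0.
have cardG F : is_spanning_tree e F -> #|G F| = #|V|.
  case/and3P => _ /eqP FV _; rewrite cardsU1 (card_imset _ Some_inj) FV.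
  by case: imsetP => [[]|] // _; rewrite add1n prednK.
have onto F f : is_spanning_tree e F -> injective f -> (forall i, f i \in G F) ->
    [set f i | i in 'I_#|V|] = G F.
  move=> tF injf fG; apply/eqP; rewrite eqEcard cardG // card_imset // card_ord leqnn andbT.
  by apply/subsetP => t /imsetP[i _ ->].
have treeP F f : is_spanning_tree e F ->
    (P f && (edges_of f == F)) = (f \in ffun_on (mem (G F))) && injectiveb f.
  move=> tF; apply/andP/andP => [[Pf /eqP <-] | [/ffun_onP fG /injectiveP injf]].
    have [injf fG _] := det_incidence_mx_neq0 v0 sg Pf.
    by split; [apply/ffun_onP | apply/injectiveP].
  have imf := onto F f tF injf fG.
  have codomE t : (t \in codom f) = (t \in G F).
    rewrite -imf; apply/codomP/imsetP => [[i ->]|[i _ ->]]; last by exists i.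
    by exists i.
  split.
    rewrite /P -absz_eq0 (absz_det_incidence_mx v0 sg tF) -?lt0n // => t.
    by rewrite codomE.
  apply/eqP/setP=> s; rewrite inE codomE !inE /=.
  by apply/imsetP/idP => [[s' sF [->]]|sF] //; exists s.
have sqE f : \det (incidence_mx e f) ^+ 2 = if P f then #|V|%:R ^+ 2 else 0.
  case: ifP => [Pf|/negbFE/eqP->]; last by rewrite expr0n.
  have [injf fG tF] := det_incidence_mx_neq0 v0 sg Pf.
  rewrite -real_normK ?num_real // -abszE natz (absz_det_incidence_mx v0 sg tF) //.
  move=> t; rewrite -[_ |: _](onto _ _ tF injf fG) => /imsetP[i _ ->].
  exact: codom_f.
transitivity (\sum_(f | P f) (#|V|%:R ^+ 2 : int)).
  by rewrite [RHS]big_mkcond; apply: eq_bigr => f _; rewrite -sqE.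
(* Families are grouped by their tree [F]; those over [F] are the injections into [G F], by
   [treeP]. *)
rewrite (partition_big (@edges_of V) (is_spanning_tree e)) => [|f Pf] /=; last first.
  by have [] := det_incidence_mx_neq0 v0 sg Pf.
transitivity (\sum_(F | is_spanning_tree e F) (#|V|`!%:R * #|V|%:R ^+ 2 : int)).
  apply: eq_bigr => F tF; 
  rewrite (eq_bigl (mem [set f in ffun_on (mem (G F)) | injectiveb f])) => [|f]; last first.
    by rewrite treeP // !inE.
  by rewrite sumr_const card_inj_ffuns_on cardG // card_ord ffactnn mulr_natl.
by rewrite sumr_const /kappa cardsE [RHS]mulrA [RHS]mulr_natr.
Qed.

(** * The clique-replaced graph *)

Lemma clique_replaced_simple (k : nat) (e : rel 'I_k) (x : 'I_k -> nat) :
  simple_graph e -> simple_graph (@clique_replaced k e x).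
Proof.
move=> [_ sym]; split=> [u|u v]; rewrite /clique_replaced ?eqxx //.
by rewrite eq_sym [tag u == _]eq_sym sym.
Qed.

Lemma prod_cr_vertex (R : comNzRingType) (k : nat) (x : 'I_k -> nat) (F : 'I_k -> R) :
  \prod_(v : {i : 'I_k & 'I_(x i)}) F (tag v) = \prod_i F i ^+ x i.
Proof.
rewrite -(sig_big_dep (J := fun i => 'I_(x i)) xpredT (fun _ _ => true) (fun i _ => F i)) /=.
by apply: eq_bigr => i _; rewrite prodr_const card_ord.
Qed.

Lemma sum_cr_vertex (R : nmodType) (k : nat) (x : 'I_k -> nat) (F : 'I_k -> R) :
  \sum_(v : {i : 'I_k & 'I_(x i)}) F (tag v) = \sum_i F i *+ x i.
Proof.
rewrite -(sig_big_dep (J := fun i => 'I_(x i)) xpredT (fun _ _ => true) (fun i _ => F i)) /=.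
by apply: eq_bigr => i _; rewrite sumr_const card_ord.
Qed.

Lemma card_cr_vertex (k : nat) (x : 'I_k -> nat) :
  #|{: {i : 'I_k & 'I_(x i)}}| = (\sum_i x i)%N.
Proof.
rewrite card_tagged sumnE big_map big_enum; apply: eq_bigr => i _.
by rewrite card_ord.
Qed.

(** The closed neighbourhood of [u] is the union of its own clique and the adjacent cliques. *)
Lemma degree_clique_replaced (k : nat) (e : rel 'I_k) (x : 'I_k -> nat)
    (u : {i : 'I_k & 'I_(x i)}) :
  simple_graph e -> #|@clique_replaced k e x u|.+1 = m_of e x (tag u).
Proof.
move=> [irr _]; set i := tag u.
have -> : #|@clique_replaced k e x u|.+1
    = #|[pred v : {i : 'I_k & 'I_(x i)} | (tag v == i) || e i (tag v)]|.
  rewrite [RHS](cardD1 u) inE eqxx add1n; congr _.+1; apply: eq_card => v.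
  by rewrite !inE /clique_replaced unfold_in /= [v == u]eq_sym [tag v == _]eq_sym.
rewrite -sum1_card big_mkcond /= /m_of.
under eq_bigr => v _ do rewrite inE.
rewrite -(sig_big_dep (J := fun i => 'I_(x i)) xpredT (fun _ _ => true)
  (fun j _ => if (j == i) || e i j then 1 else 0)%N) /=.
rewrite (bigD1 i) //= eqxx sum1_card card_ord; congr (_ + _)%N.
rewrite [LHS]big_mkcond [RHS]big_mkcond; apply: eq_bigr => j _.
have [->|ji] /= := eqVneq j i; first by rewrite irr.
case: (e i j); last by rewrite big1_eq.
by rewrite sum1_card card_ord.
Qed.

Lemma clique_replaced_det (k : nat) (e : rel 'I_k) (x : 'I_k -> nat) :
  simple_graph e -> (forall i, 0 < x i)%N ->
  let V := {i : 'I_k & 'I_(x i)} in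
  let c := @clique_replaced k e x in
  \det (\matrix_(i < #|{: V}|, j < #|{: V}|)
     ((i == j)%:R * (#|c (enum_val i)|.+1)%:R
      + ((i != j) && ~~ c (enum_val i) (enum_val j))%:R : rat))
  = (\prod_i (m_of e x i)%:R ^+ x i) / (\prod_i lambda_of e x i)
    * \det (diag_mx (\row_i lambda_of e x i) + compl_adj e).
Proof.
move=> sg x0 V c; set n := #|_|.
pose m i : rat := (m_of e x i)%:R; pose A := compl_adj e.
have m0 i : m i != 0 by rewrite pnatr_eq0 /m_of addn_eq0 negb_and -lt0n x0.
have xn0 i : (x i)%:R != 0 :> rat by rewrite pnatr_eq0 -lt0n.
pose B : 'M[rat]_(n, k) := \matrix_(i, a) (tag (enum_val i : V) == a)%:R.
pose D : 'rV[rat]_n := \row_i m (tag (enum_val i : V)).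
pose D' : 'rV[rat]_n := \row_i (m (tag (enum_val i : V)))^-1.
have BE p (Z : 'M[rat]_(k, p)) i j : (B *m Z) i j = Z (tag (enum_val i : V)) j.
  rewrite mxE (bigD1 (tag (enum_val i : V))) //= mxE eqxx mul1r big1 ?addr0 // => a.
  by rewrite mxE eq_sym => /negbTE ->; rewrite mul0r.
have BTE p (Z : 'M[rat]_(p, k)) i j : (Z *m B^T) i j = Z i (tag (enum_val j : V)).
  rewrite mxE (bigD1 (tag (enum_val j : V))) //= !mxE eqxx mulr1 big1 ?addr0 // => a.
  by rewrite !mxE eq_sym => /negbTE ->; rewrite mulr0.
set M := (X in \det X = _).
(* Distinct vertices are non-adjacent exactly when their cliques are distinct and non-adjacent,
   which is what [A] records at their tags; on the diagonal that entry is 0. *)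
have -> : M = diag_mx D *m (1%:M + (diag_mx D' *m B *m A) *m B^T).
  apply/matrixP=> i j; rewrite mul_diag_mx [RHS]mxE [X in _ * X]mxE [X in _ * (X + _)]mxE.
  rewrite BTE -mulmxA mul_diag_mx [X in _ * (_ + X)]mxE BE !mxE mulrDr mulrA mulfV // mul1r.
  rewrite degree_clique_replaced // mulrC; congr (_ + _%:R).
  rewrite /c /clique_replaced (inj_eq enum_val_inj).
  have [<-|] /= := eqVneq i j; first by rewrite eqxx.
  by rewrite negb_or.
rewrite det_mulmx det_diag det_add1_mulmxC.
have -> : \prod_i D 0 i = \prod_i m i ^+ x i.
  rewrite -prod_cr_vertex (reindex _ (onW_bij _ (enum_val_bij V))) /=.
  by apply: eq_bigr => i _; rewrite mxE.
rewrite -mulrA; congr (_ * _).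
have lam0 i : lambda_of e x i != 0.
  by apply: mulf_neq0; [exact: m0 | rewrite invr_neq0].
(* The [x a] vertices of clique [a] contribute [(m a)^-1] each, in total the inverse of
   [lambda_of e x a]. *)
have BDB : B^T *m (diag_mx D' *m B) = diag_mx (\row_i (lambda_of e x i)^-1).
  apply/matrixP=> a b; rewrite !mxE.
  transitivity (\sum_(v : V) (tag v == a)%:R * ((m (tag v))^-1 * (tag v == b)%:R)).
    rewrite [RHS](reindex _ (onW_bij _ (enum_val_bij V))) /=.
    by apply: eq_bigr => i _; rewrite mul_diag_mx !mxE.
  rewrite (sum_cr_vertex x (fun i => (i == a)%:R * ((m i)^-1 * (i == b)%:R))).
  rewrite (bigD1 a) //= eqxx mul1r big1 => [|i /negbTE ->]; last by rewrite mul0r mul0rn.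
  rewrite addr0 /lambda_of invf_div -mulrnAl -mulr_natr; case: (a == b); last by rewrite mulr0.
  by rewrite mulr1 mulr1n mulrC.
have -> : B^T *m (diag_mx D' *m B *m A) = diag_mx (\row_i (lambda_of e x i)^-1) *m A.
  by rewrite -BDB !mulmxA.
have -> : diag_mx (\row_i lambda_of e x i) + A = diag_mx (\row_i lambda_of e x i)
    *m (1%:M + diag_mx (\row_i (lambda_of e x i)^-1) *m A).
  rewrite mulmxDr mulmx1; congr (_ + _); apply/matrixP=> i j.
  by rewrite !mul_diag_mx !mxE mulrA mulfV // mul1r.
rewrite det_mulmx det_diag mulrA.
under [X in _ = _ * X * _]eq_bigr => i _ do rewrite mxE.
rewrite mulVf ?mul1r //; apply/prodf_neq0 => i _; exact: lam0.
Qed.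

(** * The complexity formula *)

Theorem theorem4p1 (k : nat) (e : rel 'I_k) (x : 'I_k -> nat) :
  (0 < k)%N ->
  simple_graph e ->
  connected_graph e ->
  (forall i, 0 < x i)%N ->
  let m := m_of e x in
  let lam := lambda_of e x in
  let Psi := \prod_(i < k) lam i in
  let n := (\sum_(i < k) x i)%N in
  let A := compl_adj e in
  (kappa (@clique_replaced k e x))%:R =
    (\prod_(i < k) ((m i)%:R ^+ (x i))) / (Psi * (n%:R) ^+ 2) *
    (Psi + \sum_(S : {set 'I_k} | S != set0)
              \det (principal_sub A S) * \prod_(i in ~: S) lam i).
Proof.
move=> k0 sg _ x0 m lam Psi n A.
pose v0 : {i : 'I_k & 'I_(x i)} := Tagged (fun i => 'I_(x i)) (Ordinal (x0 (Ordinal k0))).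
have n0 : n%:R != 0 :> rat.
  by rewrite pnatr_eq0 -lt0n /n -card_cr_vertex; apply/card_gt0P; exists v0.
have /(congr1 (intr : int -> rat)) :=
  det_laplacian_add_ones v0 (clique_replaced_simple x sg).
rewrite -det_map_mx rmorphM rmorphXn !rmorph_nat [in RHS]card_cr_vertex -/n => detE.
have -> : Psi + \sum_(S : {set 'I_k} | S != set0)
      \det (principal_sub A S) * \prod_(i in ~: S) lam i
    = \det (diag_mx (\row_i lam i) + A).
  rewrite det_diagD [RHS](bigD1 set0) //=; congr (_ + _).
  (* The empty principal minor is 1, so [S = set0] yields [Psi]; generalizing the matrix allows its
     size [#|set0|] to be rewritten to 0. *)
  rewrite (_ : \det _ = 1) ?mul1r; last first.
    by move: (\matrix_(_, _) _); rewrite cards0 => ?; rewrite det_mx00.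
  by apply: eq_bigl => i; rewrite !inE.
rewrite invfM mulrA mulrAC -clique_replaced_det //.
apply: (mulfI (expf_neq0 2 n0)); rewrite -detE [RHS]mulrCA mulfV ?expf_neq0 // mulr1.
congr (\det _); apply/matrixP=> i j; rewrite !mxE.
by rewrite rmorphD rmorphM !rmorph_nat.
Qed.
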